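(* Let $A$ be an algebra and let $M$, $M^{-1}$ be a pair of (algebraically) inverse $A$-bimodules with respect to $i_1:M\otimes_A M^{-1}\to A$, $i_2:M^{-1}\otimes_A M\to A$. Suppose that: (1) The underlying locally convex spaces of $\widehat{A}$, $\widehat{M}$ and $\widehat{M^{-1}}$ are Fréchet spaces. (2) There exist topological $\widehat{A}$-$\hat\otimes$-bimodule isomorphisms $\hat{i}_1 : \widehat{M} \hat{\otimes}_{\widehat{A}} \widehat{M^{-1}} \to \widehat{A}$ and $\hat{i}_2 : \widehat{M^{-1}} \hat{\otimes}_{\widehat{A}} \widehat{M} \to \widehat{A}$ with respect to which $\widehat M$ and $\widehat{M^{-1}}$ are topologically inverse $\widehat A$-$\hat\otimes$-bimodules, and such that $\hat i_1(i_M(x)\otimes i_{M^{-1}}(y)) = i_A(i_1(x\otimes y))$ and $\hat i_2(i_{M^{-1}}(y)\otimes i_M(x)) = i_A(i_2(y\otimes x))$ for all $x\in M$, $y\in M^{-1}$. Let $(\theta,\alpha,\beta,\widehat{L}_{\widehat{A}}(\widehat{M}))$ be the universal topologically compatible triple associated with $\widehat A$, $\widehat M$, $\widehat{M^{-1}}$, $\hat i_1$, $\hat i_2$. Then $\widehat{L_A(M)} \simeq \widehat{L}_{\widehat{A}}(\widehat{M})$, i.e. the Arens-Michael envelope of the Laurent tensor algebra $L_A(M)$ is isomorphic to the topological Laurent tensor algebra of $\widehat M$ over $\widehat A$.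
   Context: Algebras are associative unital $\mathbb{C}$-algebras. An Arens-Michael algebra is a complete locally convex algebra whose topology is defined by submultiplicative seminorms. An $A$-$\hat{\otimes}$-bimodule over an Arens-Michael algebra $A$ is a complete locally convex space with an $A$-bimodule structure such that both actions are jointly continuous; $\hat{\otimes}_A$ is the completed projective tensor product over $A$. Arens-Michael envelopes. For an algebra $A$, $(\widehat A,i_A)$ is an Arens-Michael algebra with a homomorphism $i_A:A\to\widehat A$ such that every homomorphism from $A$ to an Arens-Michael algebra factors uniquely through $i_A$ via a continuous homomorphism. For an $A$-bimodule $M$, $(\widehat M,i_M)$ is an $\widehat A$-$\hat\otimes$-bimodule with an $A$-bimodule homomorphism $i_M:M\to\widehat M$ such that every $A$-bimodule homomorphism from $M$ to an $\widehat A$-$\hat\otimes$-bimodule factors uniquely through $i_M$ via a continuous $\widehat A$-bimodule homomorphism. Algebraic notions. $A$-bimodules $M$, $M^{-1}$ are inverse with respect to $A$-bimodule isomorphisms $i_1:M\otimes_A M^{-1}\to A$, $i_2:M^{-1}\otimes_A M\to A$ if $i_1(x\otimes y)x' = x\, i_2(y\otimes x')$ and $i_2(y\otimes x)y' = y\, i_1(x\otimes y')$ for all $x,x'\in M$, $y,y'\in M^{-1}$. The Laurent tensor algebra is $L_A(M)=\bigoplus_{n\in\mathbb Z}M^{\otimes n}$, where $M^{\otimes 0}=A$, $M^{\otimes n}$ is the $n$-fold tensor power over $A$ for $n>0$, $M^{\otimes -n}=(M^{-1})^{\otimes n}$, with the unique associative multiplication for which the inclusions of the tensor algebras $T_A(M)$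 and $T_A(M^{-1})$ are homomorphisms and $x\cdot y=i_1(x\otimes y)$, $y\cdot x=i_2(y\otimes x)$ for $x\in M$, $y\in M^{-1}$. Topological notions. $A$-$\hat\otimes$-bimodules $M$, $M^{-1}$ over an Arens-Michael algebra $A$ are topologically inverse with respect to topological bimodule isomorphisms $i_1 : M \hat{\otimes}_A M^{-1} \to A$, $i_2 : M^{-1} \hat{\otimes}_A M \to A$ if the same two identities hold. For such data, a triple $(\theta,\alpha,\beta,B)$, with $B$ an Arens-Michael algebra, $\theta:A\to B$ a continuous homomorphism, $\alpha:M\to B$ and $\beta:M^{-1}\to B$ continuous $A$-bimodule homomorphisms, is topologically compatible if $\alpha(x)\beta(y)=\theta(i_1(x\otimes y))$ and $\beta(y)\alpha(x)=\theta(i_2(y\otimes x))$ for all $x\in M$, $y\in M^{-1}$. The topological Laurent tensor algebra $\widehat L_A(M)$ is the Arens-Michael algebra carrying a universal topologically compatible triple: every topologically compatible triple $(\theta',\alpha',\beta',B)$ is obtained from it by composing with a unique continuous $A$-algebra homomorphism $\widehat L_A(M)\to B$. (It exists when $A$, $M$, $M^{-1}$ are Fréchet.) *)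

(* Defs.v *)
From HB Require Import structures.
From mathcomp Require Import all_boot all_order all_algebra.
From mathcomp Require Export complex.
From mathcomp Require Import all_classical all_reals all_analysis.

Set Implicit Arguments.
Unset Strict Implicit.
Unset Printing Implicit Defensive.

Import Order.TTheory GRing.Theory Num.Theory.
Import numFieldNormedType.Exports.

Local Open Scope classical_set_scope.
Local Open Scope ring_scope.

(* MathComp's [algType] requires 1 != 0.  The zero algebra has to be allowed
   here: it is, for instance, the Arens-Michael envelope of the Weyl algebra.
   [pzRingType] cannot be joined with [lmodType] after the fact, so the product
   is declared directly on a module. *)
HB.mixin Record isUnitalAlgebra (K : numFieldType) A of GRing.Lmodule K A := {
  amul : A -> A -> A ;
  aone : A ;
  amul_linearl : forall y, linear (amul^~ y) ;
  amul_linearr : forall x, linear (amul x) ;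
  amulA : associative amul ;
  amul1x : left_id aone amul ;
  amulx1 : right_id aone amul }.

#[short(type="unitalAlgType")]
HB.structure Definition UnitalAlgebra (K : numFieldType) :=
  {A of GRing.Lmodule K A & isUnitalAlgebra K A}.

Notation "x ** y" := (amul x y) (at level 40, left associativity) : ring_scope.

HB.mixin Record isBimodule (K : numFieldType) (A : unitalAlgType K) M
    of GRing.Lmodule K M := {
  lact : A -> M -> M ;
  ract : M -> A -> M ;
  lact_linearl : forall x, linear (lact^~ x) ;
  lact_linearr : forall a, linear (lact a) ;
  ract_linearl : forall a, linear (ract^~ a) ;
  ract_linearr : forall x, linear (ract x) ;
  lact1 : forall x, lact aone x = x ;
  ract1 : forall x, ract x aone = x ;
  lactM : forall a b x, lact (a ** b) x = lact a (lact b x) ;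
  ractM : forall a b x, ract x (a ** b) = ract (ract x a) b ;
  lractA : forall a b x, ract (lact a x) b = lact a (ract x b) }.

#[short(type="bimodType")]
HB.structure Definition Bimodule (K : numFieldType) (A : unitalAlgType K) :=
  {M of GRing.Lmodule K M & isBimodule K A M}.

Notation "a *> x" := (lact a x) (at level 40, left associativity) : ring_scope.
Notation "x <* a" := (ract x a) (at level 40, left associativity) : ring_scope.

Section Morphisms.
Variable K : numFieldType.

Definition alg_hom (A B : unitalAlgType K) (f : A -> B) : Prop :=
  [/\ linear f, f aone = aone & forall x y, f (x ** y) = f x ** f y].

(* N, a B-bimodule, is seen as an A-bimodule through h. *)
Definition bimod_hom_along (A B : unitalAlgType K) (h : A -> B)
    (M : bimodType A) (N : bimodType B) (f : M -> N) : Prop :=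
  [/\ linear f, forall a x, f (a *> x) = h a *> f x
    & forall x a, f (x <* a) = f x <* h a].

(* The algebra B is seen as an A-bimodule through h. *)
Definition bimod_hom_alg (A B : unitalAlgType K) (h : A -> B) (M : bimodType A)
    (f : M -> B) : Prop :=
  [/\ linear f, forall a x, f (a *> x) = h a ** f x
    & forall x a, f (x <* a) = f x ** h a].

Definition balanced_bilinear (A : unitalAlgType K) (M N : bimodType A)
    (V : lmodType K) (f : M -> N -> V) : Prop :=
  [/\ forall y, linear (f^~ y), forall x, linear (f x)
    & forall x a y, f (x <* a) y = f x (a *> y)].

End Morphisms.

Section AlgebraicTensor.
Variables (K : numFieldType) (A : unitalAlgType K).

Definition is_tensor_product (M N T : bimodType A) (t : M -> N -> T) : Prop :=
  [/\ balanced_bilinear t,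
      forall a x y, a *> t x y = t (a *> x) y,
      forall x y a, t x y <* a = t x (y <* a)
    & forall (V : lmodType K) (f : M -> N -> V), balanced_bilinear f ->
        exists! g : T -> V, linear g /\ forall x y, g (t x y) = f x y].

Record tensor_product (M N : bimodType A) := TensorProduct {
  tens_sort :> bimodType A ;
  tens : M -> N -> tens_sort ;
  tensP : is_tensor_product tens }.

(* [tpow P n] is the tensor power of exponent n.+1, built as M ⊗ M^(⊗n). *)
Definition tpow_seq (M : bimodType A) (T : nat -> bimodType A) (n : nat) :=
  if n is n'.+1 then T n' else M.

Record tensor_powers (M : bimodType A) := TensorPowers {
  tpow_ge2 : nat -> bimodType A ;
  tpow_cons : forall n, M -> tpow_seq M tpow_ge2 n -> tpow_ge2 n ;
  tpow_consP : forall n, is_tensor_product (@tpow_cons n) }.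

Definition tpow (M : bimodType A) (P : tensor_powers M) : nat -> bimodType A :=
  tpow_seq M (tpow_ge2 P).

(* The pure tensor x ⊗ s_0 ⊗ ... ⊗ s_(n-1). *)
Fixpoint tpure (M : bimodType A) (P : tensor_powers M) (x : M) (s : seq M)
    : tpow P (size s) :=
  match s return tpow P (size s) with
  | [::] => x
  | y :: s' => tpow_cons x (tpure P y s')
  end.

Definition inverse_bimodules (M N : bimodType A)
    (MN : tensor_product M N) (NM : tensor_product N M)
    (i1 : MN -> A) (i2 : NM -> A) : Prop :=
  [/\ bimod_hom_alg idfun i1 /\ bijective i1,
      bimod_hom_alg idfun i2 /\ bijective i2,
      forall x y x', i1 (tens MN x y) *> x' = x <* i2 (tens NM y x')
    & forall y x y', i2 (tens NM y x) *> y' = y <* i1 (tens MN x y')].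

(* L is the direct sum of A (degree 0, through j0), of the M^n (degree n > 0,
   through the jM) and of the N^n (degree -n < 0, through the jN). *)
Definition is_direct_sum (M N : bimodType A) (PM : tensor_powers M)
    (PN : tensor_powers N) (L : lmodType K) (j0 : A -> L)
    (jM : forall n, tpow PM n -> L) (jN : forall n, tpow PN n -> L) : Prop :=
  [/\ linear j0, forall n, linear (@jM n), forall n, linear (@jN n)
    & forall (V : lmodType K) (f0 : A -> V) (fM : forall n, tpow PM n -> V)
        (fN : forall n, tpow PN n -> V),
        linear f0 -> (forall n, linear (@fM n)) ->
        (forall n, linear (@fN n)) ->
        exists! g : L -> V,
          [/\ linear g, forall a, g (j0 a) = f0 a,
              forall n t, g (jM n t) = fM n t
            & forall n t, g (jN n t) = fN n t]].

(* The inclusion of T_A(M), the sum of A and of the M^n, is a homomorphism for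
   the concatenation product of T_A(M); by additivity this is a condition on A
   and on the pure tensors. *)
Definition tensor_algebra_hom (M : bimodType A) (P : tensor_powers M)
    (L : unitalAlgType K) (j0 : A -> L) (j : forall n, tpow P n -> L) : Prop :=
  [/\ alg_hom j0, forall n, bimod_hom_alg j0 (@j n)
    & forall x s y u, j _ (tpure P x s) ** j _ (tpure P y u)
                      = j _ (tpure P x (s ++ y :: u))].

Definition is_laurent_algebra (M N : bimodType A)
    (MN : tensor_product M N) (NM : tensor_product N M)
    (i1 : MN -> A) (i2 : NM -> A)
    (PM : tensor_powers M) (PN : tensor_powers N)
    (L : unitalAlgType K) (j0 : A -> L)
    (jM : forall n, tpow PM n -> L) (jN : forall n, tpow PN n -> L) : Prop :=
  [/\ is_direct_sum j0 jM jN,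
      tensor_algebra_hom j0 jM,
      tensor_algebra_hom j0 jN,
      forall (x : M) (y : N), jM 0 x ** jN 0 y = j0 (i1 (tens MN x y))
    & forall (x : M) (y : N), jN 0 y ** jM 0 x = j0 (i2 (tens NM y x))].

End AlgebraicTensor.

(* "Complete" includes Hausdorff.  [tvsType] does not require its uniformity to
   be translation invariant, so Cauchy filters are those whose differences
   converge to 0. *)
HB.mixin Record Tvs_isComplete (K : numFieldType) E of Tvs K E := {
  complete_hausdorff : hausdorff_space E ;
  complete_cauchy : forall F : set_system E, ProperFilter F ->
    p.1 - p.2 @[p --> (F, F)] --> (0 : E) -> exists l : E, F --> l }.

#[short(type="completeTvsType")]
HB.structure Definition CompleteTvs (K : numFieldType) :=
  {E of Tvs K E & Tvs_isComplete K E}.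

Section Seminorms.
Variables (K : numFieldType) (E : tvsType K).

(* As for norms in MathComp, the values are the nonnegative elements of K. *)
Definition seminorm (p : E -> K) : Prop :=
  [/\ forall x, 0 <= p x, forall x y, p (x + y) <= p x + p y
    & forall k x, p (k *: x) = `|k| * p x].

Definition topology_defined_by (P : set (E -> K)) : Prop :=
  (forall p, P p -> seminorm p) /\
  forall U : set E, nbhs 0 U <->
    exists (D : set (E -> K)) (e : K),
      [/\ finite_set D, D `<=` P, 0 < e
        & [set x | forall p, D p -> p x < e] `<=` U].

Definition frechet : Prop :=
  exists2 P : set (E -> K), countable P & topology_defined_by P.

End Seminorms.

HB.mixin Record isArensMichael (K : numFieldType) A
    of UnitalAlgebra K A & CompleteTvs K A := {
  arens_michaelP : exists2 P : set (A -> K), topology_defined_by P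
    & forall p, P p -> forall x y, p (x ** y) <= p x * p y }.

#[short(type="arensMichaelType")]
HB.structure Definition ArensMichael (K : numFieldType) :=
  {A of UnitalAlgebra K A & CompleteTvs K A & isArensMichael K A}.

HB.mixin Record isTopBimodule (K : numFieldType) (A : arensMichaelType K) M
    of Bimodule K A M & CompleteTvs K M := {
  lact_continuous : continuous (fun p : A * M => p.1 *> p.2) ;
  ract_continuous : continuous (fun p : M * A => p.1 <* p.2) }.

(* The A-⊗̂-bimodules of the literature. *)
#[short(type="topBimodType")]
HB.structure Definition TopBimodule (K : numFieldType)
    (A : arensMichaelType K) :=
  {M of Bimodule K A M & CompleteTvs K M & isTopBimodule K A M}.

Definition homeo_bijection (S T : topologicalType) (f : S -> T) : Prop :=
  continuous f /\
  exists g : T -> S, [/\ cancel f g, cancel g f & continuous g].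

Definition top_alg_iso (K : numFieldType) (A B : arensMichaelType K)
    (f : A -> B) : Prop :=
  alg_hom f /\ homeo_bijection f.

Section TopologicalTensor.
Variables (K : numFieldType) (A : arensMichaelType K).

Definition is_top_tensor_product (M N T : topBimodType A) (t : M -> N -> T)
    : Prop :=
  [/\ balanced_bilinear t, continuous (fun p : M * N => t p.1 p.2),
      forall a x y, a *> t x y = t (a *> x) y,
      forall x y a, t x y <* a = t x (y <* a)
    & forall (V : completeTvsType K) (f : M -> N -> V),
        balanced_bilinear f -> continuous (fun p : M * N => f p.1 p.2) ->
        exists! g : T -> V,
          [/\ linear g, continuous g & forall x y, g (t x y) = f x y]].

Record top_tensor_product (M N : topBimodType A) := TopTensorProduct {
  ttens_sort :> topBimodType A ;
  ttens : M -> N -> ttens_sort ;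
  ttensP : is_top_tensor_product ttens }.

Definition top_inverse_bimodules (M N : topBimodType A)
    (MN : top_tensor_product M N) (NM : top_tensor_product N M)
    (i1 : MN -> A) (i2 : NM -> A) : Prop :=
  [/\ bimod_hom_alg idfun i1 /\ homeo_bijection i1,
      bimod_hom_alg idfun i2 /\ homeo_bijection i2,
      forall x y x', i1 (ttens MN x y) *> x' = x <* i2 (ttens NM y x')
    & forall y x y', i2 (ttens NM y x) *> y' = y <* i1 (ttens MN x y')].

Definition top_compatible (M N : topBimodType A)
    (MN : top_tensor_product M N) (NM : top_tensor_product N M)
    (i1 : MN -> A) (i2 : NM -> A) (B : arensMichaelType K)
    (theta : A -> B) (alpha : M -> B) (beta : N -> B) : Prop :=
  [/\ alg_hom theta /\ continuous theta,
      bimod_hom_alg theta alpha /\ continuous alpha,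
      bimod_hom_alg theta beta /\ continuous beta,
      forall x y, alpha x ** beta y = theta (i1 (ttens MN x y))
    & forall x y, beta y ** alpha x = theta (i2 (ttens NM y x))].

(* (theta, alpha, beta, L) is a universal topologically compatible triple, so
   that L is the topological Laurent tensor algebra of M over A. *)
Definition is_top_laurent_algebra (M N : topBimodType A)
    (MN : top_tensor_product M N) (NM : top_tensor_product N M)
    (i1 : MN -> A) (i2 : NM -> A) (L : arensMichaelType K)
    (theta : A -> L) (alpha : M -> L) (beta : N -> L) : Prop :=
  top_compatible i1 i2 theta alpha beta /\
  forall (B : arensMichaelType K)
    (theta' : A -> B) (alpha' : M -> B) (beta' : N -> B),
    top_compatible i1 i2 theta' alpha' beta' ->
    exists! g : L -> B,
      [/\ alg_hom g /\ continuous g, forall a, g (theta a) = theta' a,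
          forall x, g (alpha x) = alpha' x & forall y, g (beta y) = beta' y].

End TopologicalTensor.

Section Envelopes.
Variable K : numFieldType.

Definition is_envelope (A : unitalAlgType K) (E : arensMichaelType K)
    (i : A -> E) : Prop :=
  alg_hom i /\
  forall (B : arensMichaelType K) (f : A -> B), alg_hom f ->
    exists! g : E -> B,
      [/\ alg_hom g, continuous g & forall a, g (i a) = f a].

Definition is_bimod_envelope (A : unitalAlgType K) (Ah : arensMichaelType K)
    (iA : A -> Ah) (M : bimodType A) (Mh : topBimodType Ah) (iM : M -> Mh)
    : Prop :=
  bimod_hom_along iA iM /\
  forall (X : topBimodType Ah) (f : M -> X), bimod_hom_along iA f ->
    exists! g : Mh -> X,
      [/\ bimod_hom_along idfun g, continuous g & forall x, g (iM x) = f x].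

End Envelopes.

(* Main.v *)
(* Both envelopes represent the same homomorphisms, so it is enough to show
   that the map L -> Lh given by theta iA, alpha iM and beta iN is an
   Arens-Michael envelope.  A homomorphism from L to an Arens-Michael algebra B
   is an algebraic compatible triple on (A, M, N); the universal properties of
   Ah, Mh and Nh lift it to maps on (Ah, Mh, Nh), and one has to see that the
   lifted triple is still compatible.  No density argument is needed: since i2
   is onto, 1 is a sum of elements i2(y0 (x) x0), and
     x . ih2(iN y0 (x) iM x0) = ih1(x (x) iN y0) . iM x0,
     ih2(iN y0 (x) iM x0) . y = iN y0 . ih1(iM x0 (x) y),
   so that iM(M) generates Mh as a left Ah-module and iN(N) generates Nh as a
   right Ah-module. Compatibility thus only has to be checked on iM(M) x iN(N). *)
From HB Require Import structures.
Require Import Defs.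
From mathcomp Require Import all_boot all_order all_algebra.
From mathcomp Require Import complex.
From mathcomp Require Import all_classical all_reals all_analysis.

Set Implicit Arguments.
Unset Strict Implicit.
Unset Printing Implicit Defensive.

Import Order.TTheory GRing.Theory Num.Theory.

Local Open Scope classical_set_scope.
Local Open Scope ring_scope.

(** * Linear maps out of tensor products and direct sums *)

Section LinearMaps.
Variable K : numFieldType.

Lemma linear_comp (U V W : lmodType K) (g : V -> W) (f : U -> V) :
  linear g -> linear f -> linear (g \o f).
Proof. by move=> gL fL a u v; rewrite /= fL gL. Qed.

(** Composing [t] with [g] is again balanced bilinear, and both [f] and [g] are its unique
    factorization. *)
Lemma tensor_ext (A : unitalAlgType K) (M N T : bimodType A) (t : M -> N -> T)
    (V : lmodType K) (f g : T -> V) :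
  is_tensor_product t -> linear f -> linear g ->
  (forall x y, f (t x y) = g (t x y)) -> f =1 g.
Proof.
case=> [[tl tr tb] _ _ tU] fL gL fg.
have [|h [_ hU]] := tU V (fun x y => g (t x y)).
  split=> [y|x|x a y]; last by rewrite tb.
  - exact: (linear_comp gL (tl y)).
  - exact: (linear_comp gL (tr x)).
by move=> z; rewrite -(hU f) // -(hU g).
Qed.

Lemma direct_sum_ext (A : unitalAlgType K) (M N : bimodType A)
    (PM : tensor_powers M) (PN : tensor_powers N) (L V : lmodType K)
    (j0 : A -> L) (jM : forall n, tpow PM n -> L)
    (jN : forall n, tpow PN n -> L) (f g : L -> V) :
  is_direct_sum j0 jM jN -> linear f -> linear g ->
  (forall a, f (j0 a) = g (j0 a)) ->
  (forall n t, f (jM n t) = g (jM n t)) ->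
  (forall n t, f (jN n t) = g (jN n t)) -> f =1 g.
Proof.
case=> j0L jML jNL LU fL gL fg0 fgM fgN.
have [|n|n|h [_ hU]] := LU V (g \o j0) (fun n => g \o @jM n)
                              (fun n => g \o @jN n).
- exact: (linear_comp gL j0L).
- exact: (linear_comp gL (jML n)).
- exact: (linear_comp gL (jNL n)).
by move=> z; rewrite -(hU f) // -(hU g).
Qed.

Lemma direct_sumC (A : unitalAlgType K) (M N : bimodType A)
    (PM : tensor_powers M) (PN : tensor_powers N) (L : lmodType K)
    (j0 : A -> L) (jM : forall n, tpow PM n -> L)
    (jN : forall n, tpow PN n -> L) :
  is_direct_sum j0 jM jN -> is_direct_sum j0 jN jM.
Proof.
case=> j0L jML jNL LU; split=> // V f0 fN fM f0L fNL fML.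
have [h [[hL h0 hM hN] hU]] := LU V f0 fM fN f0L fML fNL.
by exists h; split=> [|h' [? ? ? ?]]; [split|apply: hU; split].
Qed.

End LinearMaps.

(** * Maps on tensor powers, degree by degree *)

Section TensorPowers.
Variables (K : numFieldType) (A : unitalAlgType K) (M : bimodType A).
Variable P : tensor_powers M.

(** Induction on the degree for all families at once: freezing the first factor [x] turns [f] into
    the family sending [t] to [f (x ⊗ t)], shifted by one degree. *)
Lemma tpow_ext (V : lmodType K) (f g : forall n, tpow P n -> V) :
  (forall n, linear (@f n)) -> (forall n, linear (@g n)) ->
  (forall x s, f _ (tpure P x s) = g _ (tpure P x s)) ->
  forall n t, f n t = g n t.
Proof.
move=> fL gL fg n; elim: n f g fL gL fg => [|n IHn] f g fL gL fg.
  by move=> x; apply: (fg x [::]).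
apply: (tensor_ext (tpow_consP P n) (fL n.+1) (gL n.+1)) => x y.
pose c (h : forall n, tpow P n -> V) m (t : tpow P m) :=
  h m.+1 (tpow_cons (t := P) x t).
apply: (IHn (c f) (c g)) => [m|m|z s].
- have [[_ r _] _ _ _] := tpow_consP P m.
  exact: (linear_comp (fL m.+1) (r x)).
- have [[_ r _] _ _ _] := tpow_consP P m.
  exact: (linear_comp (gL m.+1) (r x)).
- exact: (fg x (z :: s)).
Qed.

(** Concatenation of pure tensors determines by linearity the product of a vector with any tensor;
    later inductions on the degree use this form. *)
Lemma tensor_algebra_cons (L : unitalAlgType K) (j0 : A -> L)
    (j : forall n, tpow P n -> L) :
  tensor_algebra_hom j0 j ->
  forall x n t, j 0 x ** j n t = j n.+1 (tpow_cons (t := P) x t).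
Proof.
case=> _ jB jC x.
apply: (@tpow_ext L (fun n t => j 0 x ** j n t)) => [n|n|y s].
- have [jL _ _] := jB n; exact: (linear_comp (amul_linearr _) jL).
- have [[_ r _] _ _ _] := tpow_consP P n.
  have [jL _ _] := jB n.+1; exact: (linear_comp jL (r x)).
- exact: (jC x [::] y s).
Qed.

(** The product of the two maps is balanced because scalars act through [th] and [B] is
    associative. *)
Lemma bimod_hom_mul_tensor (B : unitalAlgType K) (th : A -> B)
    (N1 N2 T : bimodType A) (t : N1 -> N2 -> T) (f1 : N1 -> B) (f2 : N2 -> B) :
  is_tensor_product t -> bimod_hom_alg th f1 -> bimod_hom_alg th f2 ->
  exists2 g : T -> B, bimod_hom_alg th g &
    forall x y, g (t x y) = f1 x ** f2 y.
Proof.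
move=> tT [f1L f1l f1r] [f2L f2l f2r].
have [_ tl tr tU] := tT.
have [|g [[gL gE] _]] := tU B (fun x y => f1 x ** f2 y).
  split=> [y|x|x a y].
  - exact: (linear_comp (amul_linearl _) f1L).
  - exact: (linear_comp (amul_linearr _) f2L).
  - by rewrite f1r f2l amulA.
exists g => //; split=> // [a|x a].
- apply: (tensor_ext tT).
  + exact: (linear_comp gL (lact_linearr _)).
  + exact: (linear_comp (amul_linearr _) gL).
  + by move=> x y; rewrite tl !gE f1l amulA.
- move: x; apply: (tensor_ext tT).
  + exact: (linear_comp gL (ract_linearl _)).
  + exact: (linear_comp (amul_linearl _) gL).
  + by move=> x y; rewrite tr !gE f2r amulA.
Qed.

(** These are the components of the extension of [al] to the positive part of the tensor algebra. *)
Lemma tpow_hom (B : unitalAlgType K) (th : A -> B) (al : M -> B) :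
  bimod_hom_alg th al ->
  exists f : forall n, tpow P n -> B,
    [/\ forall n, bimod_hom_alg th (@f n), forall x, f 0 x = al x
      & forall n x t, f n.+1 (tpow_cons (t := P) x t) = al x ** f n t].
Proof.
move=> alB.
(* The bimodule property is carried along with the map in a sigma type, since building the next
   degree requires it. *)
have step n (f : {f : tpow P n -> B | bimod_hom_alg th f}) :
    {g : tpow P n.+1 -> B | bimod_hom_alg th g &
       forall x t, g (tpow_cons (t := P) x t) = al x ** sval f t}.
  apply: cid2; case: f => f fB /=.
  exact: (bimod_hom_mul_tensor (tpow_consP P n) alB fB).
pose F := fix F n : {f : tpow P n -> B | bimod_hom_alg th f} :=
  if n is n'.+1 then
    exist _ (s2val (step n' (F n'))) (s2valP (step n' (F n')))
  else exist _ al alB.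
exists (fun n => sval (F n)); split=> [n|x|n x t] //.
- exact: (svalP (F n)).
- exact: (s2valP' (step n (F n)) x t).
Qed.

End TensorPowers.

(** * Universal property of the Laurent tensor algebra *)

Section LaurentAlgebra.
Variable K : numFieldType.

(** The symmetry between [M] and [N] lets each computation be done for one of them only. *)
Lemma laurentC (A : unitalAlgType K) (M N : bimodType A)
    (MN : tensor_product M N) (NM : tensor_product N M)
    (i1 : MN -> A) (i2 : NM -> A) (PM : tensor_powers M) (PN : tensor_powers N)
    (L : unitalAlgType K) (j0 : A -> L) (jM : forall n, tpow PM n -> L)
    (jN : forall n, tpow PN n -> L) :
  is_laurent_algebra i1 i2 j0 jM jN -> is_laurent_algebra i2 i1 j0 jN jM.
Proof. by case=> LS tM tN i1E i2E; split=> //; apply: direct_sumC. Qed.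

(** Left multiplication by a vector of [M] lengthens tensors of [M] and, through [i1], cancels the
    first factor of tensors of [N]; the maps into [B] obey the same rules. *)
Lemma laurent_hom_mulM (A : unitalAlgType K) (M N : bimodType A)
    (MN : tensor_product M N) (NM : tensor_product N M)
    (i1 : MN -> A) (i2 : NM -> A) (PM : tensor_powers M) (PN : tensor_powers N)
    (L : unitalAlgType K) (j0 : A -> L) (jM : forall n, tpow PM n -> L)
    (jN : forall n, tpow PN n -> L) (B : unitalAlgType K) (th : A -> B)
    (fM : forall n, tpow PM n -> B) (fN : forall n, tpow PN n -> B)
    (g : L -> B) :
  is_laurent_algebra i1 i2 j0 jM jN ->
  (forall n, bimod_hom_alg th (@fM n)) ->
  (forall n x t, fM n.+1 (tpow_cons (t := PM) x t) = fM 0 x ** fM n t) ->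
  (forall n, bimod_hom_alg th (@fN n)) ->
  (forall n y t, fN n.+1 (tpow_cons (t := PN) y t) = fN 0 y ** fN n t) ->
  (forall x y, fM 0 x ** fN 0 y = th (i1 (tens MN x y))) ->
  linear g -> (forall a, g (j0 a) = th a) ->
  (forall n t, g (jM n t) = fM n t) -> (forall n t, g (jN n t) = fN n t) ->
  forall x v, g (jM 0 x ** v) = fM 0 x ** g v.
Proof.
case=> LS tM tN i1E _ fMB fMS fNB fNS fMN gL g0 gM gN x.
have [[j0L _ _] jMB _] := tM; have [_ jNB _] := tN.
apply: (direct_sum_ext LS).
- exact: (linear_comp gL (amul_linearr _)).
- exact: (linear_comp (amul_linearr _) gL).
- move=> a; have [_ _ jr] := jMB 0; have [_ _ fr] := fMB 0.
  by rewrite -jr gM g0 fr.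
- by move=> n t; rewrite (tensor_algebra_cons tM) !gM fMS.
(* Index [n] means exponent [n.+1]: index 0 is degree -1, where the product falls into [A]. *)
case=> [y|n]; first by rewrite i1E g0 gN fMN.
have [jNL _ _] := jNB n.+1; have [fNL _ _] := fNB n.+1.
apply: (tensor_ext (tpow_consP PN n)).
- exact: (linear_comp gL (linear_comp (amul_linearr _) jNL)).
- exact: (linear_comp (amul_linearr _) (linear_comp gL jNL)).
move=> y t; have [_ jl _] := jNB n; have [_ fl _] := fNB n.
(* Here [x (y t) = (x y) t = i1 (x ⊗ y) t], and the left action of [A] is preserved. *)
by rewrite gN fNS -(tensor_algebra_cons tN) !amulA i1E -jl gN fl fMN.
Qed.

(* The factors [u] for which [g] respects all products [u ** v] are stable
   under products, so it is enough to treat the generators of [L]. *)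
Lemma laurent_exists (A : unitalAlgType K) (M N : bimodType A)
    (MN : tensor_product M N) (NM : tensor_product N M)
    (i1 : MN -> A) (i2 : NM -> A) (PM : tensor_powers M) (PN : tensor_powers N)
    (L : unitalAlgType K) (j0 : A -> L) (jM : forall n, tpow PM n -> L)
    (jN : forall n, tpow PN n -> L) (B : unitalAlgType K) (th : A -> B)
    (al : M -> B) (be : N -> B) :
  is_laurent_algebra i1 i2 j0 jM jN ->
  alg_hom th -> bimod_hom_alg th al -> bimod_hom_alg th be ->
  (forall x y, al x ** be y = th (i1 (tens MN x y))) ->
  (forall x y, be y ** al x = th (i2 (tens NM y x))) ->
  exists g : L -> B, [/\ alg_hom g, forall a, g (j0 a) = th a,
    forall x, g (jM 0 x) = al x & forall y, g (jN 0 y) = be y].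
Proof.
move=> LL [thL th1 thM] alB beB abE baE.
have [fM [fMB fM0 fMS]] := tpow_hom PM alB.
have [fN [fNB fN0 fNS]] := tpow_hom PN beB.
have [LS tM tN _ _] := LL; have [[j0L j01 j0M] jMB _] := tM.
have [_ jNB _] := tN; have [_ _ _ LU] := LS.
have [n|n|g [[gL g0 gM gN] _]] := LU B th fM fN thL.
- by have [] := fMB n.
- by have [] := fNB n.
exists g; split=> // [|x|y]; [|by rewrite gM fM0|by rewrite gN fN0].
have gMl : forall x v, g (jM 0 x ** v) = fM 0 x ** g v.
  apply: (laurent_hom_mulM LL fMB _ fNB _ _ gL) => // [n x t|n y t|x y].
  - by rewrite fMS fM0.
  - by rewrite fNS fN0.
  - by rewrite fM0 fN0.
have gNl : forall y v, g (jN 0 y ** v) = fN 0 y ** g v.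
  apply: (laurent_hom_mulM (laurentC LL) fNB _ fMB _ _ gL) => // [n y t|n x t|y x].
  - by rewrite fNS fN0.
  - by rewrite fMS fM0.
  - by rewrite fM0 fN0.
have g0l a : forall v, g (j0 a ** v) = th a ** g v.
  apply: (direct_sum_ext LS).
  - exact: (linear_comp gL (amul_linearr _)).
  - exact: (linear_comp (amul_linearr _) gL).
  - by move=> b; rewrite -j0M !g0 thM.
  - by move=> n t; have [_ jl _] := jMB n; have [_ fl _] := fMB n;
      rewrite -jl !gM fl.
  - by move=> n t; have [_ jl _] := jNB n; have [_ fl _] := fNB n;
      rewrite -jl !gN fl.
split=> // [|u v]; first by rewrite -j01 g0.
move: u; apply: (direct_sum_ext LS).
- exact: (linear_comp gL (amul_linearl _)).
- exact: (linear_comp (amul_linearl _) gL).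
- by move=> a; rewrite g0l g0.
(* Beyond exponent 1, a tensor may be taken of the form [x ⊗ t]; it acts as [x] after [t], so [gMl]
   and the induction hypothesis combine by associativity. *)
- move=> n t; elim: n t v => [|n IHn] t v; first by rewrite gMl gM.
  have [jML _ _] := jMB n.+1.
  move: t; apply: (tensor_ext (tpow_consP PM n)).
  + exact: (linear_comp gL (linear_comp (amul_linearl _) jML)).
  + exact: (linear_comp (amul_linearl _) (linear_comp gL jML)).
  + by move=> x t; rewrite -(tensor_algebra_cons tM) -amulA !gMl IHn amulA.
- move=> n t; elim: n t v => [|n IHn] t v; first by rewrite gNl gN.
  have [jNL _ _] := jNB n.+1.
  move: t; apply: (tensor_ext (tpow_consP PN n)).
  + exact: (linear_comp gL (linear_comp (amul_linearl _) jNL)).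
  + exact: (linear_comp (amul_linearl _) (linear_comp gL jNL)).
  + by move=> x t; rewrite -(tensor_algebra_cons tN) -amulA !gNl IHn amulA.
Qed.

Lemma laurent_tpow_ext (A : unitalAlgType K) (M : bimodType A)
    (P : tensor_powers M) (L B : unitalAlgType K) (j0 : A -> L)
    (j : forall n, tpow P n -> L) (f g : L -> B) :
  tensor_algebra_hom j0 j -> alg_hom f -> alg_hom g ->
  (forall x, f (j 0 x) = g (j 0 x)) -> forall n t, f (j n t) = g (j n t).
Proof.
move=> tL [fL _ fM] [gL _ gM] fg; have [_ jB _] := tL.
elim=> [|n IHn]; first exact: fg.
have [jL _ _] := jB n.+1.
apply: (tensor_ext (tpow_consP P n)).
- exact: (linear_comp fL jL).
- exact: (linear_comp gL jL).
- by move=> x t; rewrite -(tensor_algebra_cons tL) fM gM fg IHn.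
Qed.

(** [L] is generated as an algebra by the images of [A], [M] and [N]. *)
Lemma laurent_ext (A : unitalAlgType K) (M N : bimodType A)
    (MN : tensor_product M N) (NM : tensor_product N M)
    (i1 : MN -> A) (i2 : NM -> A) (PM : tensor_powers M) (PN : tensor_powers N)
    (L B : unitalAlgType K) (j0 : A -> L) (jM : forall n, tpow PM n -> L)
    (jN : forall n, tpow PN n -> L) (f g : L -> B) :
  is_laurent_algebra i1 i2 j0 jM jN -> alg_hom f -> alg_hom g ->
  (forall a, f (j0 a) = g (j0 a)) -> (forall x, f (jM 0 x) = g (jM 0 x)) ->
  (forall y, f (jN 0 y) = g (jN 0 y)) -> f =1 g.
Proof.
case=> LS tM tN _ _ fH gH fg0 fgM fgN.
apply: (direct_sum_ext LS) => //.
- by have [] := fH.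
- by have [] := gH.
- exact: (laurent_tpow_ext tM).
- exact: (laurent_tpow_ext tN).
Qed.

End LaurentAlgebra.

(** * Joint continuity of the product in an Arens-Michael algebra *)

Section ArensMichael.
Variable K : numFieldType.

Lemma finite_near (I T : Type) (D : set I) (f : I -> set T) (F : set_system T) :
  Filter F -> finite_set D -> (forall i, D i -> F (f i)) ->
  F [set x | forall i, D i -> f i x].
Proof.
move=> FF /(@finite_fsetP {classic I})[s ->] Ff.
exact: (@filter_bigI _ {classic I} s f F).
Qed.

Lemma seminorm_near (E : tvsType K) (P : set (E -> K)) (p : E -> K) (a : E)
    (e : K) :
  topology_defined_by P -> P p -> 0 < e -> \forall x \near a, p (x - a) < e.
Proof.
move=> [_ PE] Pp e0.
have : nbhs (0 : E) [set x | p x < e].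
  apply/PE; exists [set p], e; split=> //; first by move=> _ ->.
  by move=> x; apply.
move/(nbhsB a); rewrite addr0; apply: filterS => _ [x /= px <-].
by rewrite addrC addKr.
Qed.

Lemma amulBl (B : unitalAlgType K) (x y z : B) : (x - y) ** z = x ** z - y ** z.
Proof.
have := amul_linearl z (-1) y x.
by rewrite !scaleN1r ![- _ + _]addrC.
Qed.

Lemma amulBr (B : unitalAlgType K) (x y z : B) : z ** (x - y) = z ** x - z ** y.
Proof.
have := amul_linearr z (-1) y x.
by rewrite !scaleN1r ![- _ + _]addrC.
Qed.

(** Submultiplicativity bounds both terms of [xy - ab = (x - a) y + a (y - b)]; finitely many
    seminorms are handled together. *)
Lemma amul_continuous (B : arensMichaelType K) :
  continuous (fun p : B * B => p.1 ** p.2).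
Proof.
have [P Pdef Psub] := @arens_michaelP K B.
have [Psn PE] := Pdef.
move=> [a b] U /= Uab.
have U0 : nbhs (0 : B) [set z | U (a ** b + z)].
  have := nbhsB (- (a ** b)) Uab; rewrite addNr; apply: filterS.
  by move=> _ [u Uu <-]; rewrite /= addNKr.
have [D [e [Dfin DP e0 DU]]] := (PE _).1 U0.
suff H : forall p, D p ->
    \forall q \near ((a, b) : B * B), p (q.1 ** q.2 - a ** b) < e.
  have := finite_near (nbhs_filter _) Dfin H.
  by apply: filterS => q qD; have := DU _ qD; rewrite /= subrKC.
move=> p Dp.
have Pp := DP _ Dp.
have [p_ge0 pD pZ] := Psn _ Pp.
have c0 : 0 < 1 + e + p a + p b.
  by rewrite -addrA ltr_wpDr ?addr_ge0// addr_gt0.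
(* The choice gives [d <= e], hence [p q.2 <= e + p b], and [d (e + p b) + p a d < e]. The summand 1
   makes the last inequality strict. *)
pose d := e / (1 + e + p a + p b).
have d0 : 0 < d by rewrite divr_gt0.
near=> q.
have qa : p (q.1 - a) < d.
  by near: q; exact: (cvg_fst (G := nbhs b) (seminorm_near a Pdef Pp d0)).
have qb : p (q.2 - b) < d.
  by near: q; exact: (cvg_snd (F := nbhs a) (seminorm_near b Pdef Pp d0)).
have -> : q.1 ** q.2 - a ** b = (q.1 - a) ** (q.2 - b + b) + a ** (q.2 - b).
  by rewrite subrK amulBl amulBr addrA subrK.
apply: le_lt_trans (pD _ _) _.
apply: (@le_lt_trans _ _ (d * (e + p b) + p a * d)).
  apply: lerD.
    apply: le_trans (Psub _ Pp _ _) _.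
    apply: ler_pM => //; first exact: ltW.
    apply: le_trans (pD _ _) _.
    rewrite lerD2r; apply: le_trans (ltW qb) _.
    rewrite /d ler_pdivrMr// ler_peMr ?(ltW e0)//.
    by rewrite -!addrA lerDl !addr_ge0// ltW.
  apply: le_trans (Psub _ Pp _ _) _.
  by apply: ler_wpM2l => //; exact: ltW.
rewrite [p a * d]mulrC -mulrDr /d mulrAC ltr_pdivrMr// ltr_pM2l//.
by rewrite -!addrA ltr_pwDl// lerD2l addrC.
Unshelve. all: by end_near.
Qed.

End ArensMichael.

(** * An Arens-Michael algebra as a bimodule along a homomorphism *)

Section RestrictionOfScalars.
Variables (K : numFieldType) (A B : arensMichaelType K) (h : A -> B).
Hypotheses (hH : alg_hom h) (hC : continuous h).

(** The proofs about [h] are parameters of this alias of [B], so that the type itself determines the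
    bimodule structure and its continuity. *)
Definition scalar_restriction of alg_hom h & continuous h : Type := B.
Let X := scalar_restriction hH hC.

HB.instance Definition _ := CompleteTvs.copy X B.

Let la (a : A) (x : X) : X := h a ** (x : B).
Let ra (x : X) (a : A) : X := (x : B) ** h a.

Let hL : linear h. Proof. by have [] := hH. Qed.
Let h1 : h aone = aone. Proof. by have [] := hH. Qed.
Let hM x y : h (x ** y) = h x ** h y. Proof. by have [] := hH. Qed.

Let la_linearl x : linear (la^~ x).
Proof. exact: (linear_comp (amul_linearl (x : B)) hL). Qed.
Let la_linearr a : linear (la a). Proof. exact: amul_linearr. Qed.
Let ra_linearl a : linear (ra^~ a). Proof. exact: amul_linearl. Qed.
Let ra_linearr x : linear (ra x).
Proof. exact: (linear_comp (amul_linearr (x : B)) hL). Qed.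
Let la1 x : la aone x = x. Proof. by rewrite /la h1 amul1x. Qed.
Let ra1 x : ra x aone = x. Proof. by rewrite /ra h1 amulx1. Qed.
Let laM a b x : la (a ** b) x = la a (la b x).
Proof. by rewrite /la hM amulA. Qed.
Let raM a b x : ra x (a ** b) = ra (ra x a) b.
Proof. by rewrite /ra hM amulA. Qed.
Let lraA a b x : ra (la a x) b = la a (ra x b).
Proof. by rewrite /la /ra amulA. Qed.

HB.instance Definition _ := isBimodule.Build K A X la_linearl la_linearr
  ra_linearl ra_linearr la1 ra1 laM raM lraA.

Let la_continuous : continuous (fun p : A * X => p.1 *> p.2).
Proof.
move=> p; have hp : ((h q.1, q.2 : B) @[q --> p]) --> (h p.1, p.2 : B).
  apply: cvg_pair; last exact: cvg_snd.
  by apply: (@continuous_comp _ _ _ fst h); [exact: cvg_fst|exact: hC].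
exact: (cvg_comp _ _ hp (@amul_continuous K B (h p.1, p.2))).
Qed.

Let ra_continuous : continuous (fun p : X * A => p.1 <* p.2).
Proof.
move=> p; have hp : ((q.1 : B, h q.2) @[q --> p]) --> (p.1 : B, h p.2).
  apply: cvg_pair; first exact: cvg_fst.
  by apply: (@continuous_comp _ _ _ snd h); [exact: cvg_snd|exact: hC].
exact: (cvg_comp _ _ hp (@amul_continuous K B (p.1, h p.2))).
Qed.

HB.instance Definition _ := isTopBimodule.Build K A X la_continuous ra_continuous.

End RestrictionOfScalars.

(** * Envelopes and the lifting of compatible triples *)

Section Envelopes.
Variable K : numFieldType.

(** Restricting scalars along [h] makes [B] a topological [Ah]-bimodule, to which the universal
    property of [Mh] applies. *)
Lemma bimod_envelope_alg (A : unitalAlgType K) (Ah : arensMichaelType K)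
    (iA : A -> Ah) (M : bimodType A) (Mh : topBimodType Ah) (iM : M -> Mh)
    (B : arensMichaelType K) (h : Ah -> B) (f : M -> B) :
  is_bimod_envelope iA iM -> alg_hom h -> continuous h ->
  bimod_hom_alg (h \o iA) f ->
  exists! g : Mh -> B,
    [/\ bimod_hom_alg h g, continuous g & forall x, g (iM x) = f x].
Proof.
move=> [_ MU] hH hC fB.
exact: (MU (scalar_restriction hH hC : topBimodType Ah) f fB).
Qed.

Lemma alg_hom_comp (A B C : unitalAlgType K) (g : B -> C) (f : A -> B) :
  alg_hom g -> alg_hom f -> alg_hom (g \o f).
Proof.
move=> [gL g1 gM] [fL f1 fM]; split=> [||x y]; first exact: linear_comp.
- by rewrite /= f1.
- by rewrite /= fM.
Qed.

Lemma bimod_hom_alg_comp (A B C : unitalAlgType K) (h : A -> B) (M : bimodType A)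
    (f : M -> B) (g : B -> C) :
  alg_hom g -> bimod_hom_alg h f -> bimod_hom_alg (g \o h) (g \o f).
Proof.
move=> [gL _ gM] [fL fl fr]; split=> [|a x|x a]; first exact: linear_comp.
- by rewrite /= fl gM.
- by rewrite /= fr gM.
Qed.

Lemma bimod_hom_along_comp (A B C : unitalAlgType K) (k : A -> B) (h : B -> C)
    (M : bimodType A) (N : bimodType B) (f : M -> N) (g : N -> C) :
  bimod_hom_alg h g -> bimod_hom_along k f -> bimod_hom_alg (h \o k) (g \o f).
Proof.
move=> [gL gl gr] [fL fl fr]; split=> [|a x|x a]; first exact: linear_comp.
- by rewrite /= fl gl.
- by rewrite /= fr gr.
Qed.

Lemma envelope_ext (A : unitalAlgType K) (E B : arensMichaelType K)
    (k : A -> E) (f g : E -> B) :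
  is_envelope k -> alg_hom f -> continuous f -> alg_hom g -> continuous g ->
  (forall a, f (k a) = g (k a)) -> f =1 g.
Proof.
move=> [kH kU] fH fC gH gC fg x.
have [u [_ uU]] := kU B (g \o k) (alg_hom_comp gH kH).
by rewrite -(uU f) // -(uU g).
Qed.

Lemma envelope_unique (A : unitalAlgType K) (E1 E2 : arensMichaelType K)
    (k1 : A -> E1) (k2 : A -> E2) :
  is_envelope k1 -> is_envelope k2 -> exists phi : E1 -> E2, top_alg_iso phi.
Proof.
move=> env1 env2; have [k1H U1] := env1; have [k2H U2] := env2.
have [f [[fH fC fE] _]] := U1 _ _ k2H.
have [g [[gH gC gE] _]] := U2 _ _ k1H.
exists f; split=> //; split=> //; exists g; split=> //.
- apply: (envelope_ext env1 (alg_hom_comp gH fH)) => [y||y|a] //.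
  + by apply: continuous_comp; [exact: fC|exact: gC].
  + by rewrite /= fE gE.
- apply: (envelope_ext env2 (alg_hom_comp fH gH)) => [y||y|a] //.
  + by apply: continuous_comp; [exact: gC|exact: fC].
  + by rewrite /= gE fE.
Qed.

(* Instead of writing 1 as a finite sum of values of [i2] on pure tensors, the
   proof uses that both sides, at [x <* iA (i2 t)] and then at
   [iA (i2 t) *> y], are linear in [t]. *)
Lemma pairing_ext (A Ah B : unitalAlgType K) (iA : A -> Ah)
    (M N : bimodType A) (Mh Nh : bimodType Ah) (iM : M -> Mh) (iN : N -> Nh)
    (NM : tensor_product N M) (i2 : NM -> A) (c : Mh -> N -> Ah)
    (d : M -> Nh -> Ah) (th : Ah -> B) (F G : Mh -> Nh -> B) :
  alg_hom iA -> bimod_hom_alg idfun i2 -> bijective i2 ->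
  (forall x y0 x0, x <* iA (i2 (tens NM y0 x0)) = c x y0 *> iM x0) ->
  (forall y0 x0 y, iA (i2 (tens NM y0 x0)) *> y = iN y0 <* d x0 y) ->
  (forall y, linear (F^~ y)) -> (forall x, linear (F x)) ->
  (forall y, linear (G^~ y)) -> (forall x, linear (G x)) ->
  (forall a x y, F (a *> x) y = th a ** F x y) ->
  (forall a x y, G (a *> x) y = th a ** G x y) ->
  (forall a x y, F x (y <* a) = F x y ** th a) ->
  (forall a x y, G x (y <* a) = G x y ** th a) ->
  (forall x y, F (iM x) (iN y) = G (iM x) (iN y)) ->
  forall x y, F x y = G x y.
Proof.
move=> [iAL iA1 _] [i2L _ _] [j _ jK] cE dE Fl Fr Gl Gr FL GL FR GR FG.
(* One variable at a time: first [y] becomes arbitrary while the other argument stays in the image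
   of [iM], then [x] does. *)
have FGy x0 y : F (iM x0) y = G (iM x0) y.
  rewrite -[y]lact1 -iA1 -[aone]jK; move: (j aone).
  apply: (tensor_ext (tensP NM)).
  - exact: (linear_comp (Fr _) (linear_comp (lact_linearl _)
             (linear_comp iAL i2L))).
  - exact: (linear_comp (Gr _) (linear_comp (lact_linearl _)
             (linear_comp iAL i2L))).
  - by move=> n m; rewrite dE FR GR FG.
move=> x y; rewrite -[x]ract1 -iA1 -[aone]jK; move: (j aone).
apply: (tensor_ext (tensP NM)).
- exact: (linear_comp (Fl _) (linear_comp (ract_linearr _)
           (linear_comp iAL i2L))).
- exact: (linear_comp (Gl _) (linear_comp (ract_linearr _)
           (linear_comp iAL i2L))).
- by move=> n m; rewrite cE FL GL FGy.
Qed.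

(** Both sides are bilinear and [Ah]-linear on the outside, so [pairing_ext] applies; the identities
    of topological inverses supply its generation hypotheses. *)
Lemma compatible_envelope (A : unitalAlgType K) (M N : bimodType A)
    (NM : tensor_product N M) (i2 : NM -> A)
    (Ah : arensMichaelType K) (iA : A -> Ah) (Mh Nh : topBimodType Ah)
    (iM : M -> Mh) (iN : N -> Nh)
    (MNh : top_tensor_product Mh Nh) (NMh : top_tensor_product Nh Mh)
    (ih1 : MNh -> Ah) (ih2 : NMh -> Ah) (B : unitalAlgType K) (th : Ah -> B)
    (al : Mh -> B) (be : Nh -> B) :
  alg_hom iA -> bimod_hom_alg idfun i2 -> bijective i2 ->
  top_inverse_bimodules ih1 ih2 ->
  (forall x y, ih2 (ttens NMh (iN y) (iM x)) = iA (i2 (tens NM y x))) ->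
  alg_hom th -> bimod_hom_alg th al -> bimod_hom_alg th be ->
  (forall x y, al (iM x) ** be (iN y) = th (ih1 (ttens MNh (iM x) (iN y)))) ->
  forall x y, al x ** be y = th (ih1 (ttens MNh x y)).
Proof.
move=> iAH i2B i2b [[[i1L i1l i1r] _] _ c1 c2] ih2E.
move=> [thL _ thM] [alL all alr] [beL bel ber].
have [[tl tr _] _ tL tR _] := ttensP MNh.
(* The coefficients are [ih1 (x ⊗ iN y0)] and [ih1 (iM x0 ⊗ y)]. *)
apply: (@pairing_ext A Ah B iA M N Mh Nh iM iN NM i2
  (fun x y0 => ih1 (ttens MNh x (iN y0)))
  (fun x0 y => ih1 (ttens MNh (iM x0) y)) th) => //.
- by move=> x y0 x0; rewrite -ih2E c1.
- by move=> y0 x0 y; rewrite -ih2E c2.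
- by move=> y; exact: (linear_comp (amul_linearl _) alL).
- by move=> x; exact: (linear_comp (amul_linearr _) beL).
- by move=> y; exact: (linear_comp thL (linear_comp i1L (tl y))).
- by move=> x; exact: (linear_comp thL (linear_comp i1L (tr x))).
- by move=> a x y; rewrite all amulA.
- by move=> a x y; rewrite -tL i1l thM.
- by move=> a x y; rewrite ber amulA.
- by move=> a x y; rewrite -tR i1r thM.
Qed.

End Envelopes.

(** * The envelope of the Laurent tensor algebra *)

Theorem proposition2p6 (R : realType) (A : unitalAlgType R[i])
  (M N : bimodType A) (MN : tensor_product M N) (NM : tensor_product N M)
  (i1 : MN -> A) (i2 : NM -> A)
  (inv : inverse_bimodules i1 i2)
  (Ah : arensMichaelType R[i]) (iA : A -> Ah) (envA : is_envelope iA)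
  (Mh : topBimodType Ah) (iM : M -> Mh) (envM : is_bimod_envelope iA iM)
  (Nh : topBimodType Ah) (iN : N -> Nh) (envN : is_bimod_envelope iA iN)
  (frechetA : frechet Ah) (frechetM : frechet Mh) (frechetN : frechet Nh)
  (MNh : top_tensor_product Mh Nh) (NMh : top_tensor_product Nh Mh)
  (ih1 : MNh -> Ah) (ih2 : NMh -> Ah)
  (invh : top_inverse_bimodules ih1 ih2)
  (ih1E : forall x y, ih1 (ttens MNh (iM x) (iN y)) = iA (i1 (tens MN x y)))
  (ih2E : forall x y, ih2 (ttens NMh (iN y) (iM x)) = iA (i2 (tens NM y x)))
  (Lh : arensMichaelType R[i])
  (theta : Ah -> Lh) (alpha : Mh -> Lh) (beta : Nh -> Lh)
  (univ : is_top_laurent_algebra ih1 ih2 theta alpha beta)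
  (PM : tensor_powers M) (PN : tensor_powers N)
  (L : unitalAlgType R[i]) (j0 : A -> L)
  (jM : forall n, tpow PM n -> L) (jN : forall n, tpow PN n -> L)
  (laurent : is_laurent_algebra i1 i2 j0 jM jN)
  (E : arensMichaelType R[i]) (iE : L -> E) (envL : is_envelope iE) :
  exists phi : E -> Lh, top_alg_iso phi.
Proof.
have [[i1B i1b] [i2B i2b] _ _] := inv.
have [iAH AU] := envA; have [iMB _] := envM; have [iNB _] := envN.
have [[[thH thC] [alB alC] [beB beC] abE baE] LU] := univ.
have [_ [j0H jMB _] [_ jNB _] jMNE jNME] := laurent.
have invhC : top_inverse_bimodules ih2 ih1 by have [? ? ? ?] := invh.
have [k [kH k0 kM kN]] : exists k : L -> Lh, [/\ alg_hom k,
    forall a, k (j0 a) = theta (iA a), forall x, k (jM 0 x) = alpha (iM x)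
    & forall y, k (jN 0 y) = beta (iN y)].
  apply: (@laurent_exists _ _ _ _ _ _ _ _ _ _ _ _ _ _ _
    (theta \o iA) (alpha \o iM) (beta \o iN) laurent).
  - exact: alg_hom_comp.
  - exact: bimod_hom_along_comp.
  - exact: bimod_hom_along_comp.
  - by move=> x y; rewrite /= abE ih1E.
  - by move=> x y; rewrite /= baE ih2E.
(* By uniqueness of envelopes, it remains to show that [k] is one. The restrictions of [f] to [A],
   [M] and [N] are lifted in turn, those to [M] and [N] along the lift [th]. *)
apply: (envelope_unique envL (k2 := k)); split=> // B f fH.
have [th [[tH tC tE] tU]] := AU B (f \o j0) (alg_hom_comp fH j0H).
have fMB : bimod_hom_alg (th \o iA) (f \o jM 0).
  by rewrite (funext tE : th \o iA = _); apply: bimod_hom_alg_comp.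
have fNB : bimod_hom_alg (th \o iA) (f \o jN 0).
  by rewrite (funext tE : th \o iA = _); apply: bimod_hom_alg_comp.
have [al [[aB aC aE] aU]] := bimod_envelope_alg envM tH tC fMB.
have [be [[bB bC bE] bU]] := bimod_envelope_alg envN tH tC fNB.
have [_ _ fM] := fH.
have comp : top_compatible ih1 ih2 th al be.
  split=> // x y.
  (* The other relation follows by exchanging [M] with [N] and [i1] with [i2]. *)
  - apply: (compatible_envelope iAH i2B i2b invh ih2E tH aB bB) => m n.
    by rewrite aE bE ih1E tE /= -fM jMNE.
  - apply: (compatible_envelope iAH i1B i1b invhC _ tH bB aB) => m n //.
    by rewrite aE bE ih2E tE /= -fM jNME.
have [g [[[gH gC] g0 gM gN] gU]] := LU B th al be comp.
exists g; split=> [|g' [g'H g'C g'E]].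
  split=> //; apply: (laurent_ext laurent (alg_hom_comp gH kH) fH) => [a|x|y] /=.
  - by rewrite k0 g0 tE.
  - by rewrite kM gM aE.
  - by rewrite kN gN bE.
(* For uniqueness, [g'] composed with [theta], [alpha], [beta] must give the lifts [th], [al], [be].
   The case of [theta] comes first, because [al] and [be] are unique only among homomorphisms along
   [th]. *)
have g'th : th = g' \o theta.
  apply: tU; split=> [||a]; first exact: alg_hom_comp.
  - by move=> a; apply: continuous_comp; [exact: thC|exact: g'C].
  - by rewrite /= -k0 g'E.
apply: gU; split=> // [a|x|y].
- by rewrite g'th.
- have -> // : al = g' \o alpha.
  apply: aU; split=> [||m].
  + by rewrite g'th; apply: bimod_hom_alg_comp.
  + by move=> m; apply: continuous_comp; [exact: alC|exact: g'C].
  + by rewrite /= -kM g'E.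
- have -> // : be = g' \o beta.
  apply: bU; split=> [||n].
  + by rewrite g'th; apply: bimod_hom_alg_comp.
  + by move=> n; apply: continuous_comp; [exact: beC|exact: g'C].
  + by rewrite /= -kN g'E.
Qed.
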